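(* Let $r$ and $a$ be odd positive integers with $a \ge 3$. Let $d$, $s$ and $x$ be positive integers such that $\frac{d+s}{r+a} = x = \frac{d}{r}$ and $x \ge 2$. Then there exists a simple $(d,d+s)$-graph which has no $(r,r+a)$-factorization with $x$ factors.
   Context: All graphs are finite simple graphs. A $(d,d+s)$-graph is a graph all of whose vertex degrees lie in $\{d, \ldots, d+s\}$. An $(r,r+a)$-factor of $G$ is a spanning subgraph all of whose degrees lie in $\{r,\ldots,r+a\}$; an $(r,r+a)$-factorization of $G$ with $x$ factors is a decomposition of $E(G)$ into $x$ edge-disjoint $(r,r+a)$-factors. *)

(* Defs.v *)
From mathcomp Require Import all_boot all_order all_algebra.

Set Implicit Arguments.
Unset Strict Implicit.
Unset Printing Implicit Defensive.

Record sgraph (V : finType) := SGraph {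
  adj :> rel V;
  adj_sym : symmetric adj;
  adj_irr : irreflexive adj
}.

Definition deg (V : finType) (G : sgraph V) (v : V) : nat := #|[set w | G v w]|.

(* [range_graph lo hi G] : G is a (lo, hi)-graph; the second argument is the
   upper bound itself, not the width of the range. *)
Definition range_graph (lo hi : nat) (V : finType) (G : sgraph V) : Prop :=
  forall v : V, lo <= deg G v <= hi.

(* A subgraph F of G is spanning because F and G share the vertex type V. *)
Definition range_factor (lo hi : nat) (V : finType) (G F : sgraph V) : Prop :=
  subrel F G /\ range_graph lo hi F.

Definition edge_disjoint (V : finType) (F H : sgraph V) : Prop :=
  forall u v : V, ~~ (F u v && H u v).

Definition range_factorization (lo hi x : nat) (V : finType) (G : sgraph V)
    (F : 'I_x -> sgraph V) : Prop :=
  [/\ forall i : 'I_x, range_factor lo hi G (F i),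
      forall i j : 'I_x, i != j -> edge_disjoint (F i) (F j)
    & forall u v : V, G u v -> exists i : 'I_x, F i u v].

(* Main.v *)
(* Since d = x r, a vertex of degree d in G has degree exactly r in each of the
   x factors, and r is odd.  If S is a set of oddly many such vertices, the
   handshake lemma forces every factor to contain an edge leaving S; as the
   factors are edge-disjoint, at least x >= 2 edges leave S.  So it suffices to
   find a graph with such an S left by at most one edge.  If d is even, take
   S = V = K_(d+1).  If d is odd, take two copies, joined by a bridge, of a
   graph on d + 2 vertices in which one vertex has degree d - 1 and all
   others have degree d. *)
Require Import Defs.
From mathcomp Require Import all_boot all_order all_algebra.

Set Implicit Arguments.
Unset Strict Implicit.
Unset Printing Implicit Defensive.

Lemma degE (V : finType) (G : sgraph V) (v : V) : deg G v = \sum_w G v w.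
Proof.
rewrite /deg -sum1_card big_mkcond; apply: eq_bigr => w _.
by rewrite inE; case: (G v w).
Qed.

(** Handshake parity by induction on [s]: a new vertex adds a row and a column with equal sums by
    symmetry, and a zero diagonal entry. *)
Lemma odd_sum_adj (V : finType) (G : sgraph V) (s : seq V) :
  odd (\sum_(u <- s) \sum_(v <- s) G u v) = false.
Proof.
elim: s => [|x s IH]; first by rewrite big_nil.
rewrite big_cons big_cons adj_irr add0n.
under [X in _ + X]eq_bigr => u _ do rewrite big_cons adj_sym.
by rewrite big_split /= addnA oddD IH addbF oddD addbb.
Qed.

Lemma odd_cut (V : finType) (F : sgraph V) (S : {set V}) :
  odd #|S| -> (forall v, v \in S -> odd (deg F v)) ->
  exists u v, [/\ u \in S, v \notin S & F u v].
Proof.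
move=> oddS oddF.
case: (boolP [exists u, exists v, [&& u \in S, v \notin S & F u v]]).
  by case/existsP=> u /existsP[v /and3P[]]; exists u, v.
move=> /existsPn no_cut.
(* With no edge leaving [S], degrees on [S] are those of the induced subgraph, so their sum is even;
   yet it has oddly many odd terms. *)
have degS u : u \in S -> deg F u = \sum_(v in S) F u v.
  move=> uS; rewrite degE [RHS]big_mkcond; apply: eq_bigr => v _.
  case: ifPn => // vS; have /existsPn/(_ v) := no_cut u.
  by rewrite uS vS /=; case: (F u v).
have sum_odd (s : seq V) :
    {in s, forall v, odd (deg F v)} -> odd (\sum_(u <- s) deg F u) = odd (size s).
  elim: s => [|x s IH] sF; first by rewrite big_nil.
  rewrite big_cons oddD sF ?mem_head // IH // => v vs.
  by apply: sF; rewrite inE vs orbT.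
have : odd (\sum_(u <- enum S) deg F u).
  by rewrite sum_odd -?cardE // => v; rewrite mem_enum; apply: oddF.
rewrite big_enum /= (eq_bigr _ degS) -big_enum /=.
by under eq_bigr => u _ do rewrite -big_enum; rewrite odd_sum_adj.
Qed.

(** Each of the [x] factors takes at least [r] of the [x * r] edges at [v], and disjointness leaves
    no room for more. *)
Lemma deg_factor (V : finType) (G : sgraph V) (r hi x : nat)
    (F : 'I_x -> sgraph V) (v : V) :
  range_factorization r hi G F -> deg G v = x * r ->
  forall i, deg (F i) v = r.
Proof.
move=> [facF disjF _] degG i.
(* The [leqif] form carries the equality case through the sum: equal totals force equality in every
   term. *)
have le_r j : true -> r <= deg (F j) v ?= iff (r == deg (F j) v).
  move=> _; apply/leqifP; have [_ /(_ v)/andP[r_le _]] := facF j.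
  by case: eqP => // /eqP r_neq; rewrite ltn_neqAle r_neq.
have [le_sum eq_sum] := leqif_sum le_r.
have sum_le : \sum_j deg (F j) v <= x * r.
  under eq_bigr => j _ do rewrite degE.
  rewrite exchange_big -degG degE; apply: leq_sum => w _.
  (* At most one factor contains the edge [v w], and only if [G] does. *)
  case: (pickP (fun j => F j v w)) => [j Fj | noF]; last first.
    by rewrite big1 // => j _; rewrite noF.
  have [/(_ v w Fj) -> _] := facF j.
  rewrite (bigD1 j) //= Fj big1 // => k kj.
  by have := disjF k j kj v w; rewrite Fj andbT => /negbTE ->.
move: eq_sum; rewrite eqn_leq le_sum sum_nat_const card_ord sum_le.
by move/esym/forallP/(_ i)/eqP.
Qed.

(** Every factor must cross the cut, hence contains [p]; factors 0 and 1 then share an edge. If no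
    edge leaves [S], any [p] will do. *)
Lemma no_factorization (V : finType) (G : sgraph V) (S : {set V})
    (r hi x : nat) :
  1 < x -> odd r -> odd #|S| -> (forall v, v \in S -> deg G v = x * r) ->
  (exists p, forall u v, u \in S -> v \notin S -> G u v -> (u, v) = p) ->
  ~ exists F : 'I_x -> sgraph V, range_factorization r hi G F.
Proof.
move=> x_gt1 r_odd S_odd degS [p cutS] [F facF].
have cutF i : F i p.1 p.2.
  have [v vS|u [v [uS vS Fuv]]] := @odd_cut _ (F i) S S_odd.
    by rewrite (deg_factor facF (degS v vS)).
  have [/(_ i)[/(_ u v Fuv) Guv _] _ _] := facF.
  by rewrite -(cutS u v uS vS Guv).
have [_ disjF _] := facF.
have /negP[] := disjF (Ordinal (ltnW x_gt1)) (Ordinal x_gt1) isT p.1 p.2.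
by rewrite !cutF.
Qed.

Section Complete.
Variable V : finType.

Definition complete_rel : rel V := fun u v => u != v.

Lemma complete_sym : symmetric complete_rel.
Proof. by move=> u v; rewrite /complete_rel eq_sym. Qed.

Lemma complete_irr : irreflexive complete_rel.
Proof. by move=> u; rewrite /complete_rel eqxx. Qed.

Definition complete := SGraph complete_sym complete_irr.

Lemma deg_complete (v : V) : deg complete v = #|V|.-1.
Proof.
rewrite -(cardsC1 v); apply: eq_card => w.
by rewrite !inE /= /complete_rel eq_sym.
Qed.

End Complete.

Section Bridge.
Variables (W : finType) (H : sgraph W) (z : W).

Definition bridge_rel : rel (bool * W) := fun p q =>
  if p.1 == q.1 then H p.2 q.2 else (p.2 == z) && (q.2 == z).

Lemma bridge_sym : symmetric bridge_rel.
Proof. by move=> p q; rewrite /bridge_rel eq_sym adj_sym andbC. Qed.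

Lemma bridge_irr : irreflexive bridge_rel.
Proof. by move=> p; rewrite /bridge_rel eqxx adj_irr. Qed.

Definition bridge := SGraph bridge_sym bridge_irr.

Lemma deg_bridge (p : bool * W) : deg bridge p = deg H p.2 + (p.2 == z).
Proof.
case: p => b w; rewrite !degE /=.
rewrite -(pair_bigA _ (fun c u => bridge_rel (b, w) (c, u) : nat)) /=.
rewrite (bigD1 b) //= (bigD1 (~~ b)) ?eqb_negLR /=; last by case: b.
rewrite [X in _ + (_ + X)]big1 ?addn0; last by case: b => [][].
rewrite /bridge_rel /= eqxx; congr (_ + _).
rewrite (bigD1 z) //= big1 => [|u /negbTE ->]; last by case: b; rewrite andbF.
by rewrite eqxx andbT addn0; case: b.
Qed.

End Bridge.

Section Gadget.
Variable k : nat.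

(* The complement of this graph consists of the path
   (true, 0) - None - (false, 0) and of the matching (true, i) - (false, i)
   for i != 0. *)
Definition gadget_rel : rel (option (bool * 'I_k.+1)) := fun p q =>
  match p, q with
  | Some (b, i), Some (c, j) => (i != j) || (i == ord0) && (b != c)
  | Some (_, i), None | None, Some (_, i) => i != ord0
  | None, None => false
  end.

Lemma gadget_sym : symmetric gadget_rel.
Proof.
move=> [[b i]|] [[c j]|] //=.
by rewrite [j == i]eq_sym [c == b]eq_sym; case: eqP => // ->.
Qed.

Lemma gadget_irr : irreflexive gadget_rel.
Proof. by move=> [[b i]|] //=; rewrite !eqxx andbF. Qed.

Definition gadget := SGraph gadget_sym gadget_irr.

(** Non-neighbours are counted instead, [p] itself included: among [2k + 3] vertices there are two
    of them, or three when [p] is [None]. The additive form matches [deg_bridge]. *)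
Lemma deg_gadget p : deg gadget p + (p == None) = k.*2.+1.
Proof.
have card_V : #|{: option (bool * 'I_k.+1)}| = k.*2.+3.
  by rewrite card_option card_prod card_bool card_ord mul2n doubleS.
suff co_card : #|~: [set q | gadget p q]| = 2 + (p == None).
  apply/eqP; rewrite -(eqn_add2r 2) -addnA [_ + 2]addnC -co_card cardsC card_V.
  by rewrite addn2.
case: p => [[b i]|]; last first.
  transitivity #|[set None; Some (true, ord0 : 'I_k.+1); Some (false, ord0)]|.
    apply: eq_card => -[[c j]|]; rewrite !inE //= negbK.
    by rewrite !(inj_eq Some_inj) !xpair_eqE; case: c; rewrite ?orbF.
  by rewrite setUC cardsU1 cards2 !inE.
have [->|i_neq0] := eqVneq i ord0.
  transitivity #|[set None; Some (b, ord0 : 'I_k.+1)]|; last by rewrite cards2.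
  apply: eq_card => -[[c j]|]; rewrite !inE //=.
  rewrite (inj_eq Some_inj) xpair_eqE negb_or !negbK andbC.
  by rewrite [c == b]eq_sym [j == _]eq_sym.
transitivity #|[set Some (true, i); Some (false, i)]|; last by rewrite cards2.
apply: eq_card => -[[c j]|]; rewrite !inE /= ?i_neq0 //.
rewrite (negbTE i_neq0) orbF negbK !(inj_eq Some_inj) !xpair_eqE [j == i]eq_sym.
by case: c; rewrite ?orbF.
Qed.

End Gadget.

Theorem theorem31 (r a d s x : nat)
  (r_pos : 0 < r) (r_odd : odd r)
  (a_pos : 0 < a) (a_odd : odd a) (a_ge3 : 3 <= a)
  (d_pos : 0 < d) (s_pos : 0 < s) (x_pos : 0 < x)
  (ratio_upper : ((d + s)%:R / (r + a)%:R = x%:R :> rat)%R)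
  (ratio_lower : (x%:R = d%:R / r%:R :> rat)%R)
  (x_ge2 : 2 <= x) :
  exists (V : finType) (G : sgraph V),
    range_graph d (d + s) G /\
    ~ exists F : 'I_x -> sgraph V, range_factorization r (r + a) G F.
Proof.
have d_eq : d = x * r.
  apply/eqP; rewrite -(Num.Theory.eqr_nat rat) GRing.natrM ratio_lower.
  by rewrite GRing.divfK // Num.Theory.pnatr_eq0 -lt0n.
have range_d V (G : sgraph V) : (forall v, deg G v = d) -> range_graph d (d + s) G.
  by move=> degG v; rewrite degG leqnn leq_addr.
have [d_odd|d_even] := boolP (odd d); last first.
  have degG v : deg (complete 'I_d.+1) v = d by rewrite deg_complete card_ord.
  exists 'I_d.+1, (complete _); split; first exact: range_d.
  apply: (@no_factorization _ _ setT) => //.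
  - by rewrite cardsT card_ord.
  - by move=> v _; rewrite degG.
  (* No vertex lies outside [setT], so the pair is arbitrary. *)
  - by exists (ord0, ord0) => u v _; rewrite inE.
(* With [d = 2k + 1], the bridge end supplies the one degree that [None] lacks. *)
have degG v : deg (bridge (gadget d./2) None) v = d.
  by rewrite deg_bridge deg_gadget -[RHS]odd_double_half d_odd.
exists (bool * option (bool * 'I_d./2.+1))%type, (bridge (gadget d./2) None).
split; first exact: range_d.
(* [S] is one copy of the gadget, of odd order [d + 2]; only the bridge leaves it. *)
apply: (@no_factorization _ _ (setX [set true] setT)) => //.
- rewrite cardsX cards1 mul1n cardsT card_option card_prod card_bool card_ord.
  by rewrite mul2n /= odd_double.
- by move=> v _; rewrite degG.
exists ((true, None), (false, None)) => -[b u] [c v].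
rewrite !inE !andbT /= => /eqP-> /negbTE; case: c => // _.
by rewrite /bridge_rel /= => /andP[/eqP-> /eqP->].
Qed.
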